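(* Let $(\boldsymbol\mu_i,\gamma_i,\Sigma_i,\Psi_i)_{i\in[n]}$ be a network setting, and let $M$ be the $n\times n$ matrix whose $i$-th column is $\boldsymbol\mu_i$. Let $Q_i=\Psi_i^T(2\gamma_i\Psi_i\Sigma_i\Psi_i^T)^{-1}\Psi_i$, let $F=\{(i,j):1\le i<j\le n,\ \Psi_i\mathbf e_j\neq \mathbf 0\}$ (with a fixed ordering), and define $n\times n$ matrices $$A_{ij}=\mathbf e_i^TQ_jM\mathbf e_j,\qquad B_{(i,j)}=\mathbf e_i\mathbf e_j^TQ_i,\qquad C_{(i,j)}=(B_{(i,j)}-B_{(j,i)})-(B_{(i,j)}-B_{(j,i)})^T.$$ Let $Z_F$ be the $|F|\times|F|$ matrix whose rows are $\mathrm{uvec}(C_{(i,j)})_F$ for $(i,j)\in F$ (in order). Then a stable point exists for this setting if and only if $\mathrm{uvec}(A-A^T)_F$ lies in the column space of $Z_F$.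
   Context: $[n]=\{1,\dots,n\}$; $\mathbf e_1,\dots,\mathbf e_n$ is the standard basis of $\mathbb R^n$. A network setting $(\boldsymbol\mu_i,\gamma_i,\Sigma_i,\Psi_i)_{i\in[n]}$ consists, for each agent $i\in[n]$, of a vector $\boldsymbol\mu_i\in\mathbb R^n$, a scalar $\gamma_i>0$, a symmetric positive definite matrix $\Sigma_i\in\mathbb R^{n\times n}$, and a constraint matrix $\Psi_i$ encoding an ordered set $J_i\subseteq[n]$ of agents with whom $i$ may form an edge (where $k\in J_i$ if and only if $i\in J_k$; $i\in J_i$ means the self-loop is permitted): $\Psi_i\in\{0,1\}^{|J_i|\times n}$ is obtained from $I_n$ by deleting the rows not indexed by $J_i$. A pair $(W,P)$ of real $n\times n$ matrices is feasible if $W=W^T$, $P=-P^T$, and $W_{ik}=P_{ik}=0$ whenever $k\notin J_i$. With $\mathbf w_i$ the $i$-th column of $W$, agent $i$'s utility is $g_i(W,P)=\mathbf w_i^T(\boldsymbol\mu_i-P\mathbf e_i)-\gamma_i\,\mathbf w_i^T\Sigma_i\mathbf w_i$. A feasible $(W,P)$ is a stable point if for every $i\in[n]$, $g_i(W,P)=\max g_i(W',P)$, the maximum being over all $W'$ such that $(W',P)$ is feasible. For an $n\times n$ matrix $X$, $\mathrm{uvec}(X)_F\in\mathbb R^{|F|}$ is the vector with entries $X_{ij}$, $(i,j)\in F$, in the fixed order of $F$. *)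

(* Defs.v *)
From HB Require Import structures.
From mathcomp Require Import all_boot all_order all_algebra.
From mathcomp Require Import reals.

Set Implicit Arguments.
Unset Strict Implicit.
Unset Printing Implicit Defensive.

Import Order.TTheory GRing.Theory Num.Theory.
Local Open Scope ring_scope.

Definition basis_vec (R : realType) (n : nat) (i : 'I_n) : 'cV[R]_n :=
  delta_mx i 0.

Definition posdef (R : realType) (n : nat) (S : 'M[R]_n) : Prop :=
  forall x : 'cV[R]_n, x != 0 -> 0 < (x^T *m S *m x) 0 0.

(* The constraint matrix Psi_i is determined by the set J_i, so the record
   stores J_i; see [Psi]. *)
Record network (R : realType) (n : nat) := Network {
  mu : 'I_n -> 'cV[R]_n;
  gamma : 'I_n -> R;
  Sigma : 'I_n -> 'M[R]_n;
  J : 'I_n -> {set 'I_n};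
  gamma_gt0 : forall i, 0 < gamma i;
  Sigma_sym : forall i, (Sigma i)^T = Sigma i;
  Sigma_posdef : forall i, posdef (Sigma i);
  J_sym : forall i k, (k \in J i) = (i \in J k)
}.

Section Network.
Variables (R : realType) (n : nat) (N : network R n).
Implicit Types (i j k : 'I_n) (W P X : 'M[R]_n).

(* [enum_val] lists J_i in increasing order, so this is the identity matrix
   with the rows not indexed by J_i deleted. *)
Definition Psi i : 'M[R]_(#|J N i|, n) :=
  rowsub (fun r : 'I_#|J N i| => enum_val r) 1%:M.

Definition feasible W P : Prop :=
  [/\ W = W^T, P = - P^T &
      forall i k, k \notin J N i -> W i k = 0 /\ P i k = 0].

Definition utility i W P : R :=
  ((col i W)^T *m (mu N i - P *m basis_vec R i)) 0 0
  - gamma N i * ((col i W)^T *m Sigma N i *m col i W) 0 0.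

Definition stable W P : Prop :=
  feasible W P /\
  forall i W', feasible W' P -> utility i W' P <= utility i W P.

Definition Mmx : 'M[R]_n := \matrix_(k, i) mu N i k 0.

Definition Q i : 'M[R]_n :=
  (Psi i)^T
    *m invmx ((2 * gamma N i) *: (Psi i *m Sigma N i *m (Psi i)^T))
    *m Psi i.

Definition F : {set 'I_n * 'I_n} :=
  [set p : 'I_n * 'I_n | (p.1 < p.2)%N & Psi p.1 *m basis_vec R p.2 != 0].

Definition A : 'M[R]_n :=
  \matrix_(i, j) ((basis_vec R i)^T *m Q j *m Mmx *m basis_vec R j) 0 0.

Definition B i j : 'M[R]_n :=
  basis_vec R i *m (basis_vec R j)^T *m Q i.

Definition C i j : 'M[R]_n :=
  (B i j - B j i) - (B i j - B j i)^T.

Definition uvec (m : nat) (s : m.-tuple ('I_n * 'I_n)) X : 'cV[R]_m :=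
  \col_r X (tnth s r).1 (tnth s r).2.

Definition Z (m : nat) (s : m.-tuple ('I_n * 'I_n)) : 'M[R]_m :=
  \matrix_(r < m) (uvec s (C (tnth s r).1 (tnth s r).2))^T.

End Network.

(* [(_ <= _)%MS] compares row spaces, hence the transposes. *)
Definition in_colspace (R : realType) (m p : nat) (v : 'cV[R]_m)
  (X : 'M[R]_(m, p)) : Prop := (v^T <= X^T)%MS.

(* Main.v *)
(* Completing the square shows that, for fixed P, the utility of agent i at a
   column w supported on J_i is its value at Q_i (mu_i - P e_i) minus
   gamma_i d^T Sigma_i d with d = w - Q_i (mu_i - P e_i). Hence a stable point
   exists iff some antisymmetric P supported on J makes the matrix with columns
   Q_i (mu_i - P e_i) symmetric. This matrix is A - T(P), where T is linear and
   T(P) - T(P)^T = C_(i,j) for P = e_i e_j^T - e_j e_i^T, so symmetry says that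
   A - A^T is a combination of the C_(i,j), (i,j) in F, that is, that
   uvec(A - A^T)_F lies in the row space of Z_F. Finally Z_F is symmetric. *)
Require Import Defs.
From HB Require Import structures.
From mathcomp Require Import all_boot all_order all_algebra.
From mathcomp Require Import reals.
From mathcomp Require Import ring lra.

Set Implicit Arguments.
Unset Strict Implicit.
Unset Printing Implicit Defensive.

Import Order.TTheory GRing.Theory Num.Theory.
Local Open Scope ring_scope.

Lemma sub_mxE (V : zmodType) m n (X Y : 'M[V]_(m, n)) i j :
  (X - Y) i j = X i j - Y i j.
Proof. by rewrite !mxE. Qed.

Lemma tr_mxE (V : Type) m n (X : 'M[V]_(m, n)) i j : X^T i j = X j i.
Proof. by rewrite mxE. Qed.

Section StablePoints.
Variables (R : realType) (n : nat) (N : network R n).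
Implicit Types (i j k : 'I_n) (W P X Y : 'M[R]_n) (v w b : 'cV[R]_n).

(** * The selection matrices [Psi N i] *)

Lemma mul_PsiE i v r : (Psi N i *m v) r 0 = v (enum_val r) 0.
Proof. by rewrite /Psi mul_rowsub_mx mul1mx mxE. Qed.

Lemma Psi_mul_tr i : Psi N i *m (Psi N i)^T = 1%:M.
Proof.
apply/matrixP=> r q; rewrite /Psi mul_rowsub_mx mul1mx !mxE.
by rewrite (inj_eq enum_val_inj) eq_sym.
Qed.

Lemma tr_Psi_mul_out i (u : 'cV_#|J N i|) k :
  k \notin J N i -> ((Psi N i)^T *m u) k 0 = 0.
Proof.
move=> kJ; rewrite mxE big1 // => r _; rewrite !mxE.
case: eqP => [rk|_]; last by rewrite mul0r.
by rewrite -rk enum_valP in kJ.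
Qed.

Lemma tr_Psi_mul_in i (u : 'cV_#|J N i|) (r : 'I_#|J N i|) :
  ((Psi N i)^T *m u) (enum_val r) 0 = u r 0.
Proof. by rewrite -mul_PsiE mulmxA Psi_mul_tr mul1mx. Qed.

Lemma tr_Psi_Psi_id i v :
  (forall k, k \notin J N i -> v k 0 = 0) -> (Psi N i)^T *m (Psi N i *m v) = v.
Proof.
move=> vJ; apply/colP=> k; case: (boolP (k \in J N i)) => kJ; last first.
  by rewrite tr_Psi_mul_out // vJ.
by rewrite -(enum_rankK_in kJ kJ) tr_Psi_mul_in mul_PsiE.
Qed.

Lemma mem_F p : (p \in F N) = (p.1 < p.2)%N && (p.2 \in J N p.1).
Proof.
rewrite inE; congr (_ && _); apply/idP/idP.
  apply: contraR => kJ; apply/eqP/colP=> r; rewrite mul_PsiE !mxE andbT.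
  by case: eqP => // rk; rewrite -rk enum_valP in kJ.
move=> kJ; apply: contraTneq isT => /colP/(_ (enum_rank_in kJ p.2)).
by rewrite mul_PsiE enum_rankK_in // !mxE !eqxx => /eqP; rewrite oner_eq0.
Qed.

(** * The matrices [Q N i] *)

Definition hessian i :=
  (2 * gamma N i) *: (Psi N i *m Sigma N i *m (Psi N i)^T).

(** A row vector [u] killed by the matrix makes the form of [Sigma N i] vanish at
    [(Psi N i)^T *m u^T], which is nonzero if [u] is, since [Psi N i] has [(Psi N i)^T] as right
    inverse. *)
Lemma hessian_unit i : hessian i \in unitmx.
Proof.
rewrite -row_free_unit -kermx_eq0; apply/rowV0P=> u /sub_kermxP uH.
apply/eqP; apply: contraTT isT => u0.
have Pu0 : (Psi N i)^T *m u^T != 0.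
  apply: contra u0 => /eqP Pu.
  by rewrite -[u]trmxK -[u^T]mul1mx -(Psi_mul_tr i) -mulmxA Pu mulmx0 trmx0.
have := Sigma_posdef N i Pu0; rewrite trmx_mul !trmxK.
have g0 : 2 * gamma N i != 0.
  by rewrite mulf_neq0 ?pnatr_eq0 // gt_eqF ?gamma_gt0.
move: uH; rewrite /hessian -scalemxAr => /eqP.
rewrite scaler_eq0 (negPf g0) /= => /eqP.
by rewrite !mulmxA => ->; rewrite mul0mx mxE ltxx.
Qed.

Lemma Q_sym i : (Q N i)^T = Q N i.
Proof.
rewrite /Q !trmx_mul trmxK trmx_inv -/(hessian i) /hessian linearZ /=.
by rewrite !trmx_mul trmxK Sigma_sym !mulmxA.
Qed.

Lemma Q_symE i j k : Q N i j k = Q N i k j.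
Proof. by rewrite -{1}Q_sym mxE. Qed.

Lemma Q_out i k j : k \notin J N i -> Q N i k j = 0.
Proof.
move=> kJ; pose u := col j (invmx (hessian i) *m Psi N i).
have -> : Q N i k j = ((Psi N i)^T *m u) k 0.
  by rewrite /u colE !mulmxA -colE [RHS]mxE.
exact: tr_Psi_mul_out.
Qed.

Lemma Q_mul_out i k b : k \notin J N i -> (Q N i *m b) k 0 = 0.
Proof. by move=> kJ; rewrite mxE big1 // => j _; rewrite Q_out ?mul0r. Qed.

Lemma Psi_Sigma_Q i :
  (2 * gamma N i) *: (Psi N i *m Sigma N i *m Q N i) = Psi N i.
Proof.
rewrite /Q -/(hessian i) !mulmxA scalemxAl scalemxAl -/(hessian i).
by rewrite mulmxV ?mul1mx ?hessian_unit.
Qed.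

(** * Best response of one agent *)

Lemma quad_sub (S : 'M[R]_n) v w : S^T = S ->
  ((v - w)^T *m S *m (v - w)) 0 0 = (v^T *m S *m v) 0 0
    - 2 * (v^T *m S *m w) 0 0 + (w^T *m S *m w) 0 0.
Proof.
move=> Ss; have wSv : (w^T *m S *m v) 0 0 = (v^T *m S *m w) 0 0.
  by rewrite -[w^T *m _ *m v]trmxK [LHS]mxE !trmx_mul trmxK Ss mulmxA.
by rewrite [(v - w)^T]linearB /= !mulmxBl !mulmxBr !sub_mxE wSv; ring.
Qed.

(** By conversion, [utility i W P] is this at [b = mu N i - P *m basis_vec R i] and
    [v = col i W]. *)
Definition payoff i b v : R :=
  (v^T *m b) 0 0 - gamma N i * (v^T *m Sigma N i *m v) 0 0.

Lemma payoffE i b v : (forall k, k \notin J N i -> v k 0 = 0) ->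
  payoff i b v = payoff i b (Q N i *m b)
    - gamma N i * ((v - Q N i *m b)^T *m Sigma N i *m (v - Q N i *m b)) 0 0.
Proof.
move=> vJ; set w := Q N i *m b.
(* Stationarity of [w], tested against directions supported on J_i; it is applied to both [v] and
   [w]. *)
have first_order (u : 'cV[R]_n) : (forall k, k \notin J N i -> u k 0 = 0) ->
    2 * gamma N i * (u^T *m Sigma N i *m w) 0 0 = (u^T *m b) 0 0.
  move=> /tr_Psi_Psi_id <-; rewrite trmx_mul trmxK; set y := (_ *m u)^T.
  have -> : y *m Psi N i *m b =
      (2 * gamma N i) *: (y *m Psi N i *m Sigma N i *m w).
    by rewrite -{1}(Psi_Sigma_Q i) -scalemxAr -scalemxAl /w !mulmxA.
  by rewrite [RHS]mxE.
have := first_order v vJ; have := first_order w (fun k => @Q_mul_out i k b).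
rewrite quad_sub ?Sigma_sym // /payoff.
by move=> {first_order}; nra.
Qed.

(** Positive definiteness makes the loss strict away from [Q N i *m b], so the maximizer is
    unique. *)
Lemma payoff_maxP i b w : (forall k, k \notin J N i -> w k 0 = 0) ->
  (forall v, (forall k, k \notin J N i -> v k 0 = 0) ->
     payoff i b v <= payoff i b w) <-> w = Q N i *m b.
Proof.
move=> wJ; split=> [wmax | -> v vJ].
  have := wmax _ (fun k => @Q_mul_out i k b).
  rewrite (payoffE b wJ) lerDl oppr_ge0; apply: contraTeq => neq.
  by rewrite -ltNge mulr_gt0 ?gamma_gt0 // Sigma_posdef // subr_eq0.
rewrite (payoffE b vJ) gerBl mulr_ge0 ?(ltW (gamma_gt0 _ _)) //.
set d := v - _; have [-> | d0] := eqVneq d 0; first by rewrite mulmx0 mxE.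
exact/ltW/Sigma_posdef.
Qed.

(** * Stable points as a symmetry condition *)

Definition supported X := forall i k, k \notin J N i -> X i k = 0.

(** Symmetry of W does not restrict a single column: placing [v] in both row and column [i], with
    zeros elsewhere, gives a feasible matrix. Agent [i] thus optimizes over all columns supported on
    J_i. *)
Lemma feasible_col (v : 'cV[R]_n) i P :
  P = - P^T -> supported P -> (forall k, k \notin J N i -> v k 0 = 0) ->
  exists2 W, feasible N W P & col i W = v.
Proof.
move=> Pa PJ vJ.
exists (\matrix_(a, c) if c == i then v a 0 else if a == i then v c 0 else 0).
  split=> //.
    apply/matrixP=> a c; rewrite !mxE.
    by case: (c =P i) => [->|_] //; case: (a =P i) => [->|].
  move=> a c cJ; rewrite mxE PJ //; split=> //.
  case: eqP => [ci|_]; first by rewrite vJ // -ci J_sym.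
  by case: eqP => // ai; rewrite vJ // -ai.
by apply/colP=> k; rewrite !mxE eqxx.
Qed.

Lemma stableP W P : feasible N W P ->
  stable N W P <-> forall i, col i W = Q N i *m (mu N i - P *m basis_vec R i).
Proof.
move=> WP; have [Ws Pa WPJ] := WP.
have colJ W' i : feasible N W' P ->
    forall k, k \notin J N i -> col i W' k 0 = 0.
  by case=> _ _ h k; rewrite mxE J_sym => /h[].
split=> [[_ opt] i | opt].
  apply/(payoff_maxP _ (colJ W i WP)) => v vJ.
  have [|W' W'P <-] := @feasible_col v i P Pa _ vJ; last exact: opt.
  by move=> a c /WPJ[].
split=> // i W' W'P; move/(payoff_maxP _ (colJ W i WP)): (opt i).
by apply; apply: colJ.
Qed.

Definition T P : 'M[R]_n := \matrix_(i, j) (Q N j *m P) i j.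

Lemma T_is_linear : linear T.
Proof.
move=> a X Y; apply/matrixP=> i j.
by rewrite [LHS]mxE mulmxDr -scalemxAr !mxE.
Qed.

HB.instance Definition _ :=
  GRing.isLinear.Build R 'M[R]_n 'M[R]_n _ T T_is_linear.

(** No support condition on [X] is required: column [k] of [T X] lies in the range of [Q N k], whose
    rows outside J_k vanish. *)
Lemma T_supported X : supported (T X).
Proof.
move=> i k; rewrite J_sym mxE mxE => iJ.
by rewrite big1 // => j _; rewrite Q_out ?mul0r.
Qed.

Lemma A_eq_T : A N = T (Mmx N).
Proof.
apply/matrixP=> i j; rewrite [LHS]mxE [RHS]mxE /basis_vec -colE trmx_delta.
by rewrite -mulmxA -rowE !mxE.
Qed.

Lemma col_response i P :
  Q N i *m (mu N i - P *m basis_vec R i) = col i (A N - T P).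
Proof.
have -> : mu N i = Mmx N *m basis_vec R i.
  by rewrite /basis_vec -colE; apply/colP=> k; rewrite !mxE.
rewrite -mulmxBl A_eq_T -linearB /= mulmxA /basis_vec -colE.
by apply/colP=> k; rewrite !mxE.
Qed.

(** Given [P], the best responses force [W = A N - T P]. Its support is automatic, so only its
    symmetry remains to be imposed. *)
Lemma exists_stableP : (exists W P, stable N W P) <->
  exists P, [/\ P = - P^T, supported P & A N - (A N)^T = T P - (T P)^T].
Proof.
split=> [[W [P st]] | [P [Pa PJ eqA]]].
  have [WP _] := st; have [Ws Pa WPJ] := WP.
  move/(stableP WP): st => Wcol; exists P; split=> [//|i k /WPJ[]//|].
  have WE : W = A N - T P.
    apply/matrixP=> k i; move/colP/(_ k): (Wcol i).
    by rewrite col_response mxE => ->; rewrite mxE.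
  apply/matrixP=> a c; move/matrixP/(_ a c): Ws.
  by rewrite WE !(sub_mxE, tr_mxE); lra.
exists (A N - T P), P.
have WP : feasible N (A N - T P) P.
  split=> //; last first.
    by move=> i k kJ; rewrite A_eq_T -linearB /= T_supported // PJ.
  move/matrixP: eqA => eqA; apply/matrixP=> i j; move: (eqA i j).
  by rewrite !(sub_mxE, tr_mxE); lra.
by apply/(stableP WP) => i; rewrite col_response.
Qed.

(** * The matrices [C N i j] *)

Lemma BE i j k l : B N i j k l = (k == i)%:R * Q N i j l.
Proof. by rewrite /B -mulmxA trmx_delta -rowE mxE big_ord1 !mxE andbT. Qed.

Lemma T_delta i j k l : T (delta_mx i j) k l = (l == j)%:R * Q N j k i.
Proof.
rewrite mxE mxE (bigD1 i) //= big1 => [|m /negPf mi]; last first.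
  by rewrite [delta_mx _ _ _ _]mxE mi mulr0.
rewrite [delta_mx _ _ _ _]mxE eqxx addr0 mulrC /=.
by case: eqP => [->|]; rewrite ?mul0r.
Qed.

(** Since [Q N j] is symmetric, [T (delta_mx i j)] is the transpose of [B N j i]. *)
Lemma T_skew_delta i j (E := delta_mx i j - delta_mx j i : 'M[R]_n) :
  T E - (T E)^T = C N i j.
Proof.
apply/matrixP=> k l; rewrite /E linearB /= /C.
rewrite !(sub_mxE, tr_mxE, T_delta, BE).
by rewrite !(Q_symE _ _ i) !(Q_symE _ _ j); ring.
Qed.

(** Exchanging the two index pairs fixes two of the four terms and swaps the other two. This is what
    makes [Z N s] symmetric. *)
Lemma C_pair_sym i j k l : C N i j k l = C N k l i j.
Proof.
have swap (a b c d : 'I_n) : (a == c)%:R * Q N c b d = (c == a)%:R * Q N a d b.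
  by rewrite eq_sym Q_symE; case: eqP => [->|]; rewrite ?mul0r.
rewrite /C !(sub_mxE, tr_mxE, BE) (swap k i) (swap k j) (swap l i) (swap l j).
by ring.
Qed.

(** * Coordinates indexed by [F N] *)

Section Coordinates.
Variable s : #|F N|.-tuple ('I_n * 'I_n).
Hypothesis s_F : perm_eq s (enum (F N)).

Lemma tnth_F r : tnth s r \in F N.
Proof. by rewrite -mem_enum -(perm_mem s_F) mem_tnth. Qed.

Lemma tnth_inj : injective (tnth s).
Proof. by apply/tuple_uniqP; rewrite (perm_uniq s_F) enum_uniq. Qed.

Lemma ZE r q :
  Z N s r q = C N (tnth s r).1 (tnth s r).2 (tnth s q).1 (tnth s q).2.
Proof. by rewrite mxE mxE mxE. Qed.

Lemma Z_sym : (Z N s)^T = Z N s.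
Proof. by apply/matrixP=> r q; rewrite tr_mxE !ZE C_pair_sym. Qed.

(** Entries above the diagonal are listed in [s] or vanish by support; antisymmetry gives those
    below and a zero diagonal. *)
Lemma uvec_inj X Y : X = - X^T -> Y = - Y^T -> supported X -> supported Y ->
  uvec s X = uvec s Y -> X = Y.
Proof.
move=> Xa Ya XJ YJ /colP eqXY.
have upper i j : (i < j)%N -> X i j = Y i j.
  move=> ij; case: (boolP (j \in J N i)) => jJ; last by rewrite XJ // YJ.
  have : (i, j) \in tval s by rewrite (perm_mem s_F) mem_enum mem_F ij.
  by case/tnthP=> r ijE; have := eqXY r; rewrite !mxE -ijE.
have anti (V : 'M[R]_n) : V = - V^T -> forall i j, V i j = - V j i.
  by move=> E i j; rewrite {1}E !mxE.
apply/matrixP=> i j; case: (ltngtP i j) => [||/val_inj->]; first exact: upper.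
  by move=> ji; rewrite (anti X Xa) (anti Y Ya) upper.
by have := anti X Xa j j; have := anti Y Ya j j; lra.
Qed.

(** Up to transposition, the inverse of [uvec s] on supported antisymmetric matrices. *)
Definition skew (D : 'rV[R]_#|F N|) : 'M[R]_n :=
  \sum_r D 0 r *: (delta_mx (tnth s r).1 (tnth s r).2
                   - delta_mx (tnth s r).2 (tnth s r).1).

Lemma skew_anti D : skew D = - (skew D)^T.
Proof.
rewrite /skew linear_sum -sumrN; apply: eq_bigr => r _.
by rewrite linearZ /= -scalerN [trmx _]linearB /= !trmx_delta opprB.
Qed.

Lemma skew_supported D : supported (skew D).
Proof.
move=> i k kJ; rewrite summxE big1 // => r _; have := tnth_F r.
rewrite mem_F !mxE; case: (tnth s r) => a c /= /andP[_ cJ].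
suff [-> ->] : (i == a) && (k == c) = false /\ (i == c) && (k == a) = false.
  by rewrite subrr mulr0.
split; apply: contraNF kJ => /andP[/eqP-> /eqP->] //; by rewrite J_sym.
Qed.

Lemma uvec_skew D : uvec s (skew D) = D^T.
Proof.
apply/colP=> q; rewrite !mxE summxE (bigD1 q) //= big1 ?addr0 => [|r rq].
  have := tnth_F q; rewrite mem_F !mxE !eqxx => /andP[lt _].
  by rewrite -val_eqE /= ltn_eqF // subr0 mulr1.
have := tnth_F q; have := tnth_F r; rewrite !mem_F !mxE.
move=> /andP[r12 _] /andP[q12 _].
rewrite -xpair_eqE -!surjective_pairing (inj_eq tnth_inj) eq_sym (negPf rq).
(* Both pairs are strictly increasing, so neither is the reverse of the other. *)
suff /negPf-> : ~~ (((tnth s q).1 == (tnth s r).2) &&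
    ((tnth s q).2 == (tnth s r).1)).
  by rewrite subrr mulr0.
apply/negP=> /andP[/eqP e1 /eqP e2]; move: q12; rewrite e1 e2.
by rewrite ltnNge (ltnW r12).
Qed.

Lemma uvec_T_skew D :
  uvec s (T (skew D) - (T (skew D))^T) = (D *m Z N s)^T.
Proof.
have -> : T (skew D) - (T (skew D))^T =
    \sum_r D 0 r *: C N (tnth s r).1 (tnth s r).2.
  rewrite /skew [T _]linear_sum linear_sum /= -sumrB; apply: eq_bigr => r _.
  rewrite -T_skew_delta [T _]linearZ [in RHS]scalerBr.
  by congr (_ - _); rewrite linearZ.
apply/colP=> q; rewrite mxE summxE tr_mxE mxE; apply: eq_bigr => r _.
by rewrite ZE mxE.
Qed.

Lemma exists_skewP :
  (exists P, [/\ P = - P^T, supported P & A N - (A N)^T = T P - (T P)^T]) <->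
  in_colspace (uvec s (A N - (A N)^T)) (Z N s).
Proof.
have T_anti X : T X - (T X)^T = - (T X - (T X)^T)^T.
  by rewrite linearB /= trmxK opprB.
have T_diff_supported X : supported (T X - (T X)^T).
  move=> i k kJ; rewrite mxE T_supported // add0r mxE mxE T_supported ?oppr0 //.
  by rewrite J_sym.
(* Symmetry of [Z N s] turns the claim into row-space membership, whose coefficients [D] are the
   coordinates of [P]. *)
rewrite /in_colspace Z_sym; split=> [[P [Pa PJ ->]] | /submxP[D AD]].
  apply/submxP; exists (uvec s P)^T.
  have {1 2}-> : P = skew (uvec s P)^T.
    apply: uvec_inj => //; first exact: skew_anti.
      exact: skew_supported.
    by rewrite uvec_skew trmxK.
  by rewrite uvec_T_skew trmxK.
exists (skew D); split; [exact: skew_anti | exact: skew_supported |].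
apply: uvec_inj; rewrite ?A_eq_T //.
by rewrite uvec_T_skew -AD trmxK A_eq_T.
Qed.

End Coordinates.
End StablePoints.

Theorem theorem1 (R : realType) (n : nat) (N : network R n)
    (s : #|F N|.-tuple ('I_n * 'I_n)) (s_F : perm_eq s (enum (F N))) :
  (exists W P : 'M[R]_n, stable N W P) <->
  in_colspace (uvec s (A N - (A N)^T)) (Z N s).
Proof. exact: iff_trans (exists_stableP N) (exists_skewP s_F). Qed.
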